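(* Fix the number of awards $n$. For $k$ agents, let $p_{i,k}$ denote the winning probability of agent $i$ (the $i$-th ranked agent) in a subgame perfect equilibrium of the $k$-agent competitive secretary game with deferred selections and ranked tie-breaking, and let $q_i$ denote the probability that agent $i$ receives the highest award in the subgame perfect equilibrium of the immediate-selection game with ranked tie-breaking (both defined in the context; $q_i$ does not depend on $k$). Then for every $i$, $\lim_{k\to\infty} p_{i,k}=q_i$.
   Context: Deferred-selection game: $n$ non-negative real awards are revealed one per time step in a uniformly random order ($v_t$ at time $t$). There are $k$ agents with a fixed global ranking $1,2,\dots,k$ (agent 1 highest). Upon the revelation of $v_t$, every agent without an award (active) may select any not-yet-assigned award among $v_1,\dots,v_t$, or pass; an award selected by several agents goes to the highest-ranked among them; agents receiving an award become inactive; if active agents remain after time $n$, they continue competing over the remaining available awards. Agent $i$ wins if she receives the highest allocated award; agents rank outcomes by the lexicographic order on the vector of probabilities of receiving the 1st, 2nd, ... highest allocated award, and a subgame perfect equilibrium is a profile that is a Nash equilibrium in every subgame. Immediate-selection game: same arrival process and ranking, but at time $t$ each active agent may only accept or reject the current award $v_t$, immediately and irrevocably; if several agents accept it, it goes to the highest-ranked of them, who then leaves. Each agent wishes to maximize the probability of receiving the highest award; $q_i$ is this probability for agent $i$ in the subgame perfect equilibrium of this game. *)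

(* Defs.v *)
(* Model of the two secretary games of the paper.
   Conventions:
   - awards are revealed at times 0..n-1 (0-based); a uniformly random
     permutation [pi : {perm 'I_n}] gives the rank of each award:
     [pi t] is the rank of the award revealed at time t (rank 0 = highest);
   - agents are ['I_k], agent 0 is the highest-ranked one (agent "1" of the
     paper is the ordinal 0);
   - at round r agents observe the relative order of the awards revealed so
     far (the first [minn r.+1 n] ones) and all past actions of all agents;
   - strategies are pure (deterministic) behavioural strategies. *)
From mathcomp Require Import all_boot all_order all_fingroup all_algebra.
Set Implicit Arguments.
Unset Strict Implicit.
Unset Printing Implicit Defensive.
Import Order.TTheory GRing.Theory Num.Theory.
Local Open Scope ring_scope.

Section Common.
Variable n : nat.

Definition Obs := {ffun ('I_n * 'I_n)%type -> bool}.

Definition obs (r : nat) (pi : {perm 'I_n}) : Obs :=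
  [ffun p : ('I_n * 'I_n)%type =>
     [&& (p.1 < minn r.+1 n)%N, (p.2 < minn r.+1 n)%N & (pi p.1 < pi p.2)%N]].

Definition ncompat (r : nat) (o : Obs) : nat :=
  #|[set pi : {perm 'I_n} | obs r pi == o]|.

Definition lexlt (u v : nat -> rat) : Prop :=
  exists l : 'I_n, (forall l' : 'I_n, (l' < l)%N -> u l' = v l') /\ u l < v l.

End Common.

(* Rounds 0..n-1: award r is revealed then agents act; rounds n..n+k-1: the  *)
(* remaining active agents keep competing over the remaining awards.         *)
Section Deferred.
Variables n k : nat.

(* an action: select the award revealed at a given time, or pass *)
Definition dprofile := {ffun 'I_k -> option 'I_n}.
(* assignment: the award (by revelation time) held by each agent *)
Definition dassignment := {ffun 'I_k -> option 'I_n}.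

Definition dstrategy := 'I_k -> nat -> Obs n -> seq dprofile -> option 'I_n.

Definition dempty : dassignment := [ffun => None].

Definition davailable (a : dassignment) (s : 'I_n) : bool :=
  [forall j, a j != Some s].

(* one round: each active agent's selection of a revealed, unassigned award
   succeeds unless a higher-ranked active agent selects the same award;
   invalid selections count as passing. *)
Definition dstep (r : nat) (a : dassignment) (x : dprofile) : dassignment :=
  [ffun j => match a j with
     | Some s => Some s
     | None =>
       match x j with
       | Some s =>
         if [&& (s < minn r.+1 n)%N, davailable a s &
                [forall j' : 'I_k, (j' < j)%N ==>
                    ~~ ((x j' == Some s) && (a j' == None))]]
         then Some s else None
       | None => None
       end
     end].

Fixpoint dassign_from (r : nat) (a : dassignment) (h : seq dprofile)
  : dassignment :=
  match h with
  | [::] => a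
  | x :: h' => dassign_from r.+1 (dstep r a x) h'
  end.

Fixpoint drun (sigma : dstrategy) (pi : {perm 'I_n}) (r : nat)
    (h : seq dprofile) (fuel : nat) : seq dprofile :=
  match fuel with
  | 0 => h
  | f.+1 =>
    let x : dprofile := [ffun j => sigma j r (obs r pi) h] in
    drun sigma pi r.+1 (rcons h x) f
  end.

Definition horizon := (n + k)%N.

Definition doutcome (sigma : dstrategy) (pi : {perm 'I_n}) (r : nat)
    (h : seq dprofile) : dassignment :=
  dassign_from 0 dempty (drun sigma pi r h (horizon - r)).

Definition dreceives (pi : {perm 'I_n}) (a : dassignment) (j : 'I_k)
    (l : nat) : bool :=
  if a j is Some s then
    #|[set j' : 'I_k | if a j' is Some s' then (pi s' < pi s)%N else false]|
      == l
  else false.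

Definition dpayoff (sigma : dstrategy) (r : nat) (h : seq dprofile)
    (o : Obs n) (j : 'I_k) : nat -> rat :=
  fun l => (\sum_(pi : {perm 'I_n} | obs r pi == o)
              (dreceives pi (doutcome sigma pi r h) j l)%:R)
           / (ncompat r o)%:R.

Definition ddeviate (sigma : dstrategy) (j : 'I_k)
    (tau : nat -> Obs n -> seq dprofile -> option 'I_n) : dstrategy :=
  fun j' => if j' == j then tau else sigma j'.

Definition dSPE (sigma : dstrategy) : Prop :=
  forall (r : nat) (h : seq dprofile) (pi0 : {perm 'I_n}) (j : 'I_k)
         (tau : nat -> Obs n -> seq dprofile -> option 'I_n),
    size h = r -> (r < horizon)%N ->
    ~ lexlt n (dpayoff sigma r h (obs r pi0) j)
              (dpayoff (ddeviate sigma j tau) r h (obs r pi0) j).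

(* winning probability of the agent of 0-based index i (0 if i >= k) *)
Definition dwin (sigma : dstrategy) (i : nat) : rat :=
  if insub i is Some j then
    (\sum_(pi : {perm 'I_n}) (dreceives pi (doutcome sigma pi 0 [::]) j 0)%:R)
      / #|{perm 'I_n}|%:R
  else 0.

End Deferred.

Section Immediate.
Variables n k : nat.

Definition iprofile := {ffun 'I_k -> bool}.
Definition iassignment := {ffun 'I_k -> option 'I_n}.
Definition istrategy := 'I_k -> nat -> Obs n -> seq iprofile -> bool.

Definition iempty : iassignment := [ffun => None].

Definition istep (r : nat) (a : iassignment) (x : iprofile) : iassignment :=
  [ffun j => match a j with
     | Some s => Some s
     | None =>
       match insub r with
       | Some t =>
         if x j && [forall j' : 'I_k, (j' < j)%N ==>
                       ~~ (x j' && (a j' == None))]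
         then Some t else None
       | None => None
       end
     end].

Fixpoint iassign_from (r : nat) (a : iassignment) (h : seq iprofile)
  : iassignment :=
  match h with
  | [::] => a
  | x :: h' => iassign_from r.+1 (istep r a x) h'
  end.

Fixpoint irun (sigma : istrategy) (pi : {perm 'I_n}) (r : nat)
    (h : seq iprofile) (fuel : nat) : seq iprofile :=
  match fuel with
  | 0 => h
  | f.+1 =>
    let x : iprofile := [ffun j => sigma j r (obs r pi) h] in
    irun sigma pi r.+1 (rcons h x) f
  end.

Definition ioutcome (sigma : istrategy) (pi : {perm 'I_n}) (r : nat)
    (h : seq iprofile) : iassignment :=
  iassign_from 0 iempty (irun sigma pi r h (n - r)).

Definition iwins (pi : {perm 'I_n}) (a : iassignment) (j : 'I_k) : bool :=
  if a j is Some s then (pi s == 0 :> nat) else false.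

Definition ipayoff (sigma : istrategy) (r : nat) (h : seq iprofile)
    (o : Obs n) (j : 'I_k) : rat :=
  (\sum_(pi : {perm 'I_n} | obs r pi == o) (iwins pi (ioutcome sigma pi r h) j)%:R)
    / (ncompat r o)%:R.

Definition ideviate (sigma : istrategy) (j : 'I_k)
    (tau : nat -> Obs n -> seq iprofile -> bool) : istrategy :=
  fun j' => if j' == j then tau else sigma j'.

Definition iSPE (sigma : istrategy) : Prop :=
  forall (r : nat) (h : seq iprofile) (pi0 : {perm 'I_n}) (j : 'I_k)
         (tau : nat -> Obs n -> seq iprofile -> bool),
    size h = r -> (r < n)%N ->
    ~ (ipayoff sigma r h (obs r pi0) j
       < ipayoff (ideviate sigma j tau) r h (obs r pi0) j).

Definition iwin (sigma : istrategy) (i : nat) : rat :=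
  if insub i is Some j then
    (\sum_(pi : {perm 'I_n}) (iwins pi (ioutcome sigma pi 0 [::]) j)%:R)
      / #|{perm 'I_n}|%:R
  else 0.

End Immediate.

(* Main.v *)
Require Import Defs.
From mathcomp Require Import all_boot all_order all_fingroup all_algebra.
From mathcomp Require Import zify.
Set Implicit Arguments.
Unset Strict Implicit.
Unset Printing Implicit Defensive.
Import Order.TTheory GRing.Theory Num.Theory.
Local Open Scope ring_scope.

(* For k > n + n! the two winning probabilities are equal.  In both games the
   equilibrium winning probability of an active agent depends only on the
   observation, on the number m of active agents above her, and on the
   conditional probability c that an available award is the best of all: with
   v_0 >= v_1 >= ... the continuation values, it is the m-th term of the
   decreasing sequence obtained by inserting c into v, however ties are
   resolved.
   What reduces the deferred game to this recursion is that at most n! active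
   agents have a positive winning probability, so when there are many agents
   one of them has nothing to lose; hence an award that may be the best one is
   taken in the very round where it is available.  Off the equilibrium path,
   when such an award was left over, c can only be larger than in the immediate
   game, so passing still guarantees the continuation value. *)

(** * Conditional expectation *)

Section ConditionalExpectation.
Variable T : finType.
Implicit Types (f : T -> rat) (x y z : T).

(** Conditional expectation under the uniform law on [T]. The condition is given by a point [x] and
    not by a value of [g], so the fiber is never empty. *)
Definition cexp (G : eqType) (g : T -> G) f x : rat :=
  (\sum_(y | g y == g x) f y) / #|[set y | g y == g x]|%:R.

Lemma fiber_card_gt0 (G : eqType) (g : T -> G) x :
  0 < #|[set y | g y == g x]|%:R :> rat.
Proof. by rewrite ltr0n card_gt0; apply/set0Pn; exists x; rewrite inE. Qed.

Lemma eq_cexp (G : eqType) (g : T -> G) f f' x :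
  (forall y, g y = g x -> f y = f' y) -> cexp g f x = cexp g f' x.
Proof. by move=> eqf; congr (_ / _); apply: eq_bigr => y /eqP/eqf. Qed.

Lemma le_cexp (G : eqType) (g : T -> G) f f' x :
  (forall y, g y = g x -> f y <= f' y) -> cexp g f x <= cexp g f' x.
Proof.
move=> lef; rewrite ler_pM2r ?invr_gt0 ?fiber_card_gt0 //.
by apply: ler_sum => y /eqP/lef.
Qed.

Lemma cexp0 (G : eqType) (g : T -> G) x : cexp g (fun=> 0) x = 0.
Proof. by rewrite /cexp big1 ?mul0r. Qed.

Lemma cexp_ge0 (G : eqType) (g : T -> G) f x :
  (forall y, g y = g x -> 0 <= f y) -> 0 <= cexp g f x.
Proof. by move=> f_ge0; rewrite -(cexp0 g x); apply: le_cexp. Qed.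

Lemma cexp_gt0 (G : eqType) (g : T -> G) f x y :
  (forall z, 0 <= f z) -> g y = g x -> 0 < f y -> 0 < cexp g f x.
Proof.
move=> f_ge0 gyx fy; rewrite divr_gt0 ?fiber_card_gt0 //.
rewrite (bigD1 y) ?gyx //= ltr_pwDl // sumr_ge0 //.
Qed.

Lemma cexp_bool_gt0P (G : eqType) (g : T -> G) (p : pred T) x :
  reflect (exists2 y, g y = g x & p y) (0 < cexp g (fun y => (p y)%:R) x).
Proof.
apply: (iffP idP) => [|[y gyx py]]; last first.
  by apply: (cexp_gt0 (y := y)); rewrite ?py ?ltr01 // => z; rewrite ler0n.
move=> c_gt0; have [/existsP[y /andP[/eqP ? ?]]|] :=
  boolP [exists y, (g y == g x) && p y]; first by exists y.
rewrite negb_exists => /forallP no; move: c_gt0.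
rewrite (_ : cexp _ _ _ = 0) ?ltxx // -(cexp0 g x).
by apply: eq_cexp => y gyx; have := no y; rewrite gyx eqxx /= => /negbTE ->.
Qed.

(** [p] is a union of fibers of [g], and in the double sum each [f y] occurs once per point of its
    fiber, weighted by the inverse of the fiber's size. *)
Lemma sum_cexp (G : eqType) (g : T -> G) (p : pred T) f :
  (forall y z, g y = g z -> p y = p z) ->
  \sum_(x | p x) cexp g f x = \sum_(x | p x) f x.
Proof.
move=> gp; rewrite /cexp; under eq_bigr do rewrite big_distrl /=.
rewrite (exchange_big_dep p) /=; last first.
  by move=> x y px /eqP/gp ->.
apply: eq_bigr => y py.
rewrite (eq_bigl (fun x => g x == g y)); last first.
  move=> x; rewrite eq_sym; case: eqP => [/gp ->|]; rewrite ?andbF //.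
  by rewrite py.
under eq_bigr => x /eqP -> do [].
rewrite sumr_const -mulrnAr -[_^-1 *+ _]mulr_natl -[X in X%:R / _]cardsE.
rewrite divff ?mulr1 //.
by rewrite gt_eqF ?fiber_card_gt0.
Qed.

Lemma cexp_tower (G G' : eqType) (g : T -> G) (g' : T -> G') f x :
  (forall y z, g' y = g' z -> g y = g z) ->
  cexp g (cexp g' f) x = cexp g f x.
Proof. by move=> gg; congr (_ / _); apply: sum_cexp => y z /gg ->. Qed.

End ConditionalExpectation.

(** * One round of the game *)

(** For decreasing [v] this is the median of [v m], [c] and the term before [v m], which is read as
    infinite when [m] is 0. *)
Definition insert (m : nat) (c : rat) (v : nat -> rat) : rat :=
  Num.max (v m) (if m is m'.+1 then Num.min c (v m') else c).

Lemma le_insert m c c' v v' :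
  c <= c' -> (forall i, v i <= v' i) -> insert m c v <= insert m c' v'.
Proof.
move=> cc vv; rewrite /insert ge_max !le_max vv /=.
case: m => [|m]; first by rewrite cc orbT.
by rewrite le_min !ge_min cc vv !orbT.
Qed.

Lemma insert_ge m c v : v m <= insert m c v.
Proof. by rewrite le_max lexx. Qed.

Lemma insert_anti c v : {homo v : m m' / (m <= m')%N >-> m' <= m} ->
  {homo (fun m => insert m c v) : m m' / (m <= m')%N >-> m' <= m}.
Proof.
move=> v_anti; apply: (homo_leq (r := fun x y : rat => y <= x)) => //.
  by move=> x y z yx zy; exact: le_trans zy yx.
move=> m; rewrite /insert ge_max !le_max v_anti //=.
by rewrite ge_min lexx orbT.
Qed.

Section Stage.
Variable k : nat.
Implicit Types (A B : {set 'I_k}) (i j : 'I_k).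

Definition rk A j : nat := #|[set i in A | (i < j)%N]|.

Lemma rk_subset A B i j : [set l in A | (l < i)%N] \subset B ->
  (i <= j)%N -> (rk A i <= rk B j)%N.
Proof.
move=> /subsetP AB ij; apply: subset_leq_card; apply/subsetP => l.
move=> lA; rewrite inE AB //=; move: lA; rewrite inE => /andP[_ li].
exact: leq_trans ij.
Qed.

Lemma rk_mono A B j : B \subset A -> (rk B j <= rk A j)%N.
Proof.
move=> /subsetP BA; apply: rk_subset => //; apply/subsetP => l.
by rewrite inE => /andP[/BA].
Qed.

Lemma rk_ltn A B i j : B \subset A -> i \in A :\: B -> (i < j)%N ->
  (rk B j < rk A j)%N.
Proof.
move=> /subsetP BA; rewrite inE => /andP[iNB iA] ij.
apply: proper_card; apply/properP; split.
  by apply/subsetP => l; rewrite !inE => /andP[/BA -> ->].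
by exists i; rewrite !inE ?iA ?ij // (negbTE iNB).
Qed.

Lemma rk_setU1 A B f (g : 'I_k) j :
  [set l in A | (l < g)%N] \subset f |: B -> (g <= j)%N ->
  (rk A g <= (rk B j).+1)%N.
Proof.
move=> /subsetP AB gj.
suff: (rk A g <= #|f |: [set l in B | (l < j)%N]|)%N.
  by move/leq_trans; apply; rewrite cardsU1 -add1n leq_add2r; case: (_ \notin _).
apply: subset_leq_card; apply/subsetP => l lA.
have := AB l lA; rewrite !inE => /orP[-> //|->].
by move: lA; rewrite inE => /andP[_ /leq_trans -> //]; rewrite orbT.
Qed.

Lemma rk_pred A j m : rk A j = m.+1 ->
  exists i, [/\ i \in A, (i < j)%N & rk A i = m].
Proof.
move=> rkj; have: (0 < rk A j)%N by rewrite rkj.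
rewrite card_gt0 => /set0Pn [i0 i0P].
pose i := [arg max_(l > i0 in [set l in A | (l < j)%N]) val l].
have [iP imax] : i \in [set l in A | (l < j)%N] /\
    forall l, l \in [set l in A | (l < j)%N] -> (l <= i)%N.
  by rewrite /i; case: arg_maxnP => // l lP lmax; split.
move: (iP); rewrite inE => /andP[iA ij]; exists i; split => //.
have rkS : rk A j = #|[set l in A | (l < j)%N] :\ i|.+1.
  by rewrite /rk (cardsD1 i) iP.
apply: succn_inj; rewrite -rkj rkS; congr _.+1; apply: eq_card => l.
rewrite !inE.
have := imax l; rewrite inE; case: (l \in A); rewrite ?andbF //=.
by rewrite -(inj_eq val_inj) /= => lmax; apply/idP/idP; lia.
Qed.

(* [A] and [B] are the sets of active agents before and after a round, [c] the
   probability that the contested award is the best one, [w] the agent who takes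
   it, and [v m] the continuation value of an active agent with [m] active
   agents above her.  The equilibrium payoffs [P] are only bounded below by the
   available deviations; the matching upper bound is the content. *)
Lemma stage_value A B (w : option 'I_k) (v : nat -> rat) (c : rat)
    (P : 'I_k -> rat) :
    B \subset A -> {homo v : m m' / (m <= m')%N >-> m' <= m} ->
    (forall m, 0 <= v m) -> 0 <= c ->
    (forall j, j \in A -> insert (rk A j) c v <= P j) ->
    (forall j, j \in B -> P j = v (rk B j)) ->
    (forall j, j \in A :\: B -> P j = 0 \/
      [/\ w = Some j, P j = c &
          forall i, i \in A -> (i < j)%N -> c <= P i]) ->
  forall j, j \in A -> P j = insert (rk A j) c v.
Proof.
move=> BA v_anti v_ge0 c_ge0 lbP PB PD j jA.
apply/eqP; rewrite eq_le lbP // andbT.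
have [jB|jNB] := boolP (j \in B); last first.
  have /PD[->|[wj -> cP]] : j \in A :\: B by rewrite inE jNB.
    exact: le_trans (insert_ge _ _ _).
  rewrite /insert le_max; case rkj: (rk A j) => [|m]; first by rewrite lexx orbT.
  rewrite le_min lexx /=.
  have [c0|c_gt0] := lerP c 0; first by rewrite (le_trans c0).
  (* The active agent just above [j] could have taken the award, so [c <= P i]. Nobody above [j]
     leaves, since a leaver other than [w] has payoff 0, which is less than [c]; hence
     [P i <= v m]. *)
  have [i [iA ij rki]] := rk_pred rkj.
  have AB l : l \in A -> (l < j)%N -> l \in B.
    move=> lA lj; apply/negPn/negP => lNB.
    have /PD[Pl0|[]] : l \in A :\: B by rewrite inE lNB.
      by have := cP l lA lj; rewrite Pl0 leNgt c_gt0.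
    by rewrite wj => -[jl]; rewrite jl ltnn in lj.
  apply/orP; right; apply: (le_trans (cP i iA ij)); rewrite PB ?AB // -rki.
  rewrite v_anti //; apply: rk_subset => //; apply/subsetP => l.
  by rewrite inE => /andP[lA li]; rewrite AB // (ltn_trans li).
(* From here on [j] stays. The cases are that no agent above her leaves, that only [f] does, or that
   [f] and then [g] are the two highest-ranked to leave. *)
rewrite PB //; pose D := [set i in A :\: B | (i < j)%N].
have DP i : (i \in D) = [&& i \in A, i \notin B & (i < j)%N].
  by rewrite !inE andbA [(i \in A) && _]andbC.
have [D0|[f0 f0D]] := set_0Vmem D.
  rewrite (_ : rk A j = rk B j); first exact: insert_ge.
  apply: eq_card => l; rewrite !inE; have := DP l; rewrite D0 inE.
  have := subsetP BA l.
  by case: (l \in A); case: (l \in B) => //= H; case: (l < j)%N => //; have := H isT.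
pose f := [arg min_(l < f0 in D) val l].
have [fD fmin] : f \in D /\ forall l, l \in D -> (f <= l)%N.
  by rewrite /f; case: arg_minnP.
move: (fD); rewrite DP => /and3P[fA fNB fj].
have rkf : (rk A f <= rk B j)%N.
  apply: rk_subset; last exact: ltnW.
  apply/subsetP => l; rewrite inE => /andP[lA lf]; apply/negPn/negP => lNB.
  by have := fmin l; rewrite DP lA lNB (ltn_trans lf) //= leqNgt lf => /(_ isT).
have vf : v (rk B j) <= P f.
  exact: le_trans (v_anti _ _ rkf) (le_trans (insert_ge _ _ _) (lbP f fA)).
have /PD[Pf0|[wf Pfc _]] : f \in A :\: B by rewrite inE fNB.
  by rewrite Pf0 in vf; apply: (le_trans vf); exact: le_trans (insert_ge _ _ _).
rewrite Pfc in vf.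
have [Df0|[g0 g0D]] := set_0Vmem (D :\ f).
  rewrite (_ : rk A j = (rk B j).+1).
    by rewrite /insert le_max le_min vf lexx orbT.
  apply/eqP; rewrite eqn_leq; apply/andP; split; last first.
    by apply: (@rk_ltn _ _ f); rewrite // inE fNB.
  apply: (@rk_setU1 _ _ f) => //; apply/subsetP => l; rewrite inE => /andP[lA lj].
  have: l \notin D :\ f by rewrite Df0 inE.
  by rewrite in_setD1 DP lA lj andbT !inE negb_and !negbK.
pose g := [arg min_(l < g0 in D :\ f) val l].
have [gD gmin] : g \in D :\ f /\ forall l, l \in D :\ f -> (g <= l)%N.
  by rewrite /g; case: arg_minnP.
move: (gD); rewrite in_setD1 DP => /and4P[gf gA gNB gj].
(* Only [f] leaves with payoff [c], so [g] gets 0. Her lower bound, at a rank of at most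
   [rk B j + 1], then forces [v (rk B j) <= 0]. *)
have Pg0 : P g = 0.
  have /PD[//|[wg _ _]] : g \in A :\: B by rewrite inE gNB.
  by move: wg gf; rewrite wf => -[->]; rewrite eqxx.
have rkg : (rk A g <= (rk B j).+1)%N.
  apply: (@rk_setU1 _ _ f); last exact: ltnW.
  apply/subsetP => l; rewrite inE => /andP[lA lg]; rewrite !inE.
  apply/norP => -[lf lNB].
  have := gmin l; rewrite in_setD1 lf DP lA lNB (ltn_trans lg) //=.
  by rewrite leqNgt lg => /(_ isT).
suff v0 : v (rk B j) <= 0.
  by apply: (le_trans v0); exact: le_trans (insert_ge _ _ _).
have := lbP g gA; rewrite Pg0 /insert ge_max => /andP[vg].
case: (rk A g) rkg vg => [_ vg _|m]; first exact: le_trans (v_anti _ _ _) vg.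
rewrite ltnS => mB _; rewrite ge_min => /orP[c0|vm]; first exact: le_trans c0.
exact: le_trans (v_anti _ _ mB) vm.
Qed.

End Stage.

(** * Equilibria of the immediate-selection game *)

Section Value.
Variable n : nat.
Implicit Types (pi : {perm 'I_n}) (A : pred 'I_n).

Lemma obs_refine r pi pi' : obs r.+1 pi = obs r.+1 pi' -> obs r pi = obs r pi'.
Proof.
have minS : (minn r.+1 n <= minn r.+2 n)%N by lia.
move=> /ffunP eq_obs; apply/ffunP => -[s t]; rewrite !ffunE /=.
have := eq_obs (s, t); rewrite !ffunE /=.
have [sr|] := ltnP s (minn r.+1 n) => //=.
have [tr|] := ltnP t (minn r.+1 n) => //=.
by rewrite (leq_trans sr minS) (leq_trans tr minS).
Qed.

(** * Values by backward induction *)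

Definition topin A pi : bool := [exists s, A s && (pi s == 0 :> nat)].

Definition newtop r pi : rat :=
  cexp (obs r) (fun pi' => (topin (fun s => s == r :> nat)%N pi')%:R) pi.

(** [d] counts the rounds left, so the current round is [n - d]. The number of agents does not
    occur, which is why both games can be compared for different [k]. *)
Fixpoint value_rec (d m : nat) pi : rat :=
  if d is d'.+1 then
    insert m (newtop (n - d) pi)
             (fun m' => cexp (obs (n - d)) (value_rec d' m') pi)
  else 0.

Definition value r := value_rec (n - r).

Definition contval r pi (m : nat) : rat := cexp (obs r) (value r.+1 m) pi.

Lemma valueS r m pi : (r < n)%N ->
  value r m pi = insert m (newtop r pi) (contval r pi).
Proof.
move=> rn; rewrite /value -(subnSK rn) /=.
by rewrite (_ : n - (n - r.+1).+1 = r)%N //; lia.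
Qed.

Lemma value_end r m pi : (n <= r)%N -> value r m pi = 0.
Proof. by move=> nr; rewrite /value (_ : n - r = 0)%N //; lia. Qed.

Lemma newtop_ge0 r pi : 0 <= newtop r pi.
Proof. by apply: cexp_ge0 => ? _; rewrite ler0n. Qed.

Lemma value_ge0 r m pi : 0 <= value r m pi.
Proof.
rewrite /value; elim: (n - r)%N m pi => //= d IH m pi.
by apply: le_trans (insert_ge _ _ _); apply: cexp_ge0.
Qed.

Lemma value_anti r pi : {homo value r ^~ pi : m m' / (m <= m')%N >-> m' <= m}.
Proof.
rewrite /value; elim: (n - r)%N pi => //= d IH pi.
apply: insert_anti => m m' mm'; apply: le_cexp => pi' _; exact: IH.
Qed.

Lemma contval_ge0 r pi m : 0 <= contval r pi m.
Proof. by apply: cexp_ge0 => ? _; apply: value_ge0. Qed.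

Lemma contval_anti r pi : {homo contval r pi : m m' / (m <= m')%N >-> m' <= m}.
Proof. by move=> m m' mm'; apply: le_cexp => ? _; apply: value_anti. Qed.

End Value.

(** * Play of the immediate-selection game *)

Definition override (k : nat) (X : Type) (x : {ffun 'I_k -> X}) (j : 'I_k) (b : X) :
  {ffun 'I_k -> X} := [ffun j' => if j' == j then b else x j'].

Lemma overrideE k X (x : {ffun 'I_k -> X}) j b j' :
  override x j b j' = if j' == j then b else x j'.
Proof. by rewrite ffunE. Qed.

Section ImmediateGame.
Variables n k : nat.
Implicit Types (sigma : istrategy n k) (pi : {perm 'I_n}) (h : seq (iprofile k)).
Implicit Types (a : iassignment n k) (x : iprofile k) (j : 'I_k).

Definition iheld h : iassignment n k := iassign_from 0 (iempty n k) h.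

Definition iactive h : {set 'I_k} := [set j | iheld h j == None].

Lemma iheld_rcons h x : iheld (rcons h x) = istep (size h) (iheld h) x.
Proof.
rewrite /iheld; move: (iempty n k) => a; rewrite -[size h]add0n.
by elim: h 0%N a => [|y h IH] r a /=; rewrite ?addn0 // IH addSnnS.
Qed.

Lemma iheld_keep h x j s : iheld h j = Some s -> iheld (rcons h x) j = Some s.
Proof. by move=> hj; rewrite iheld_rcons ffunE hj. Qed.

Lemma iactive_rcons h x : iactive (rcons h x) \subset iactive h.
Proof.
apply/subsetP => j; rewrite !inE => hx.
by case hj: (iheld h j) hx => [s|] //; rewrite (iheld_keep _ hj).
Qed.

Lemma ioutcome_keep sigma pi r h j s :
  iheld h j = Some s -> ioutcome sigma pi r h j = Some s.
Proof.
rewrite /ioutcome; move: (n - r)%N => d; elim: d r h => [|d IH] r h hj //=.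
by apply: IH; apply: iheld_keep.
Qed.

Lemma ioutcomeS sigma pi r h : (r < n)%N ->
  ioutcome sigma pi r h =
  ioutcome sigma pi r.+1 (rcons h [ffun j => sigma j r (obs r pi) h]).
Proof. by move=> rn; rewrite /ioutcome -(subnSK rn). Qed.

Lemma eq_ioutcome sigma sigma' pi r h :
  (forall j r' o h', (r <= r')%N -> sigma j r' o h' = sigma' j r' o h') ->
  ioutcome sigma pi r h = ioutcome sigma' pi r h.
Proof.
rewrite /ioutcome => eqs; congr iassign_from.
move: (n - r)%N => d; elim: d r h eqs => [|d IH] r h eqs //=.
rewrite (_ : finfun _ = [ffun j => sigma' j r (obs r pi) h]).
  by apply: IH => j r' o h' rr'; apply: eqs; apply: ltnW.
by apply/ffunP => j; rewrite !ffunE eqs.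
Qed.

Lemma istepE r (rn : (r < n)%N) a x j : a j = None ->
  istep r a x j = if x j && [forall j' : 'I_k, (j' < j)%N ==>
                                ~~ (x j' && (a j' == None))]
                  then Some (Ordinal rn) else None.
Proof. by move=> aj; rewrite ffunE aj insubT. Qed.

Lemma istep_contested r (rn : (r < n)%N) a x j : a j = None -> x j ->
  exists f : 'I_k, [/\ (f <= j)%N, a f = None & istep r a x f = Some (Ordinal rn)].
Proof.
move=> aj xj; pose S := [pred l : 'I_k | x l && (a l == None)].
have jS : S j by rewrite /= xj aj.
case: (arg_minnP (fun l : 'I_k => val l) jS) => f /andP[xf /eqP af] fmin.
exists f; split => //; first exact: fmin.
rewrite (istepE rn) // xf (_ : [forall _, _]) //.
apply/forallP => l; apply/implyP => lf; apply/negP => lS.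
by have := fmin l lS; rewrite leqNgt lf.
Qed.

Section Equilibrium.
Variable sigma : istrategy n k.
Hypothesis Hsigma : iSPE sigma.

(** Here [h] already contains the actions of round [r], while the condition is still the observation
    made in that round. *)
Definition icont r h pi0 j : rat :=
  cexp (obs r) (fun pi => (iwins pi (ioutcome sigma pi r.+1 h) j)%:R) pi0.

Lemma ipayoff_cont r h pi0 j : (r < n)%N ->
  ipayoff sigma r h (obs r pi0) j =
  icont r (rcons h [ffun j => sigma j r (obs r pi0) h]) pi0 j.
Proof. by move=> rn; apply: eq_cexp => pi eqo; rewrite ioutcomeS // eqo. Qed.

(** One-shot deviation: [dev] plays [b] in round [r] and follows [sigma] afterwards. *)
Lemma icont_le_ipayoff r h pi0 j b : size h = r -> (r < n)%N ->
  icont r (rcons h (override [ffun j => sigma j r (obs r pi0) h] j b)) pi0 j <=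
  ipayoff sigma r h (obs r pi0) j.
Proof.
move=> hr rn; rewrite leNgt; apply/negP.
pose dev r' o h' := if r' == r then b else sigma j r' o h'.
suff -> : icont r (rcons h (override [ffun j => sigma j r (obs r pi0) h] j b)) pi0 j =
  ipayoff (ideviate sigma j dev) r h (obs r pi0) j by exact: Hsigma.
apply: eq_cexp => pi eqo; rewrite [ioutcome (ideviate _ _ _) _ _ _]ioutcomeS //.
rewrite (_ : [ffun l => ideviate sigma j dev l r (obs r pi) h] =
             override [ffun l => sigma l r (obs r pi0) h] j b); last first.
  apply/ffunP => l; rewrite !ffunE /ideviate eqo.
  by case: eqP => // _; rewrite /dev eqxx.
congr (iwins _ _ _)%:R; apply: eq_ioutcome => l r' o h' rr'.
rewrite /ideviate /dev; case: eqP => [->|//].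
by rewrite gtn_eqF.
Qed.

Lemma icont_taken r (rn : (r < n)%N) h pi0 j : iheld h j = Some (Ordinal rn) ->
  icont r h pi0 j = newtop r pi0.
Proof.
move=> hj; apply: eq_cexp => pi _; rewrite /iwins (ioutcome_keep _ _ _ hj).
congr (nat_of_bool _)%:R; apply/idP/existsP => [piS|[s /andP[/eqP sr]]].
  by exists (Ordinal rn); rewrite eqxx.
by rewrite (_ : s = Ordinal rn) //; apply: val_inj.
Qed.

Lemma icont_active r h pi0 j :
    (forall pi, ipayoff sigma r.+1 h (obs r.+1 pi) j
                = value r.+1 (rk (iactive h) j) pi) ->
  icont r h pi0 j = contval r pi0 (rk (iactive h) j).
Proof.
move=> IH; rewrite /icont -(cexp_tower (g' := obs r.+1)); last exact: obs_refine.
by apply: eq_cexp => pi _; apply: IH.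
Qed.

(** Induction on the number of rounds left; each step is [stage_value] with the award of round [r]
    as the contested one. *)
Lemma ipayoff_value r h pi0 j : (r <= n)%N -> size h = r -> j \in iactive h ->
  ipayoff sigma r h (obs r pi0) j = value r (rk (iactive h) j) pi0.
Proof.
elim: {r}(n - r)%N {-2}r (erefl (n - r)%N) h pi0 j => [|d IH] r rd h pi0 j rn hr jA.
  rewrite value_end; last by lia.
  rewrite -(cexp0 (obs r) pi0); apply: eq_cexp => pi _.
  rewrite /ioutcome rd /iwins -/(iheld h).
  by move: jA; rewrite inE => /eqP ->.
have {}rn : (r < n)%N by lia.
pose x : iprofile k := [ffun j => sigma j r (obs r pi0) h].
(* The next three facts are stated for any profile [y], because they serve both the equilibrium
   actions and the deviations. *)
have stayE y l : l \in iactive (rcons h y) ->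
    icont r (rcons h y) pi0 l = contval r pi0 (rk (iactive (rcons h y)) l).
  move=> lB; apply: icont_active => pi; apply: IH => //; first by lia.
  by rewrite size_rcons hr.
have takeP y l : l \in iactive h -> l \notin iactive (rcons h y) ->
    iheld (rcons h y) l = Some (Ordinal rn) /\ y l /\
    forall i, i \in iactive h -> (i < l)%N -> y i = false.
  rewrite !inE => /eqP lA; rewrite iheld_rcons hr (istepE rn) //.
  case: ifP => // /andP[yl /forallP ylt] _; split=> //; split=> // i; rewrite inE => iA il.
  by have := ylt i; rewrite il iA andbT => /negbTE.
have winE y l : l \in iactive h -> l \notin iactive (rcons h y) ->
    icont r (rcons h y) pi0 l = newtop r pi0.
  by move=> lA lB; have [/icont_taken -> //] := takeP y l lA lB.
rewrite valueS //; pose w := [pick l in iactive h :\: iactive (rcons h x)].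
apply: (@stage_value _ _ (iactive (rcons h x)) w _ _
         (fun j => ipayoff sigma r h (obs r pi0) j)) => //.
- exact: iactive_rcons.
- exact: contval_anti.
- exact: contval_ge0.
- exact: newtop_ge0.
- move=> l lA; rewrite /insert ge_max; apply/andP; split.
    apply: le_trans (icont_le_ipayoff pi0 l false hr rn).
    rewrite stayE; first exact: contval_anti (rk_mono _ (iactive_rcons _ _)).
    move: lA; rewrite !inE => /eqP lA; rewrite iheld_rcons hr (istepE rn) //.
    by rewrite overrideE eqxx.
  (* By accepting, [l] either gets the award or loses it to some [f] above her. In the second case
     one agent fewer remains above [l], which yields the term before [v m]. *)
  have := icont_le_ipayoff pi0 l true hr rn; set y := override _ _ _.
  have [lB|lNB] := boolP (l \in iactive (rcons h y)); last first.
    by rewrite winE //; case: (rk _ _) => [//|m] /(le_trans _) -> //; rewrite ge_min lexx.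
  rewrite stayE // => lP.
  have [f [fl fA fS]] : exists f : 'I_k, [/\ (f <= l)%N, iheld h f = None &
      istep r (iheld h) y f = Some (Ordinal rn)].
    apply: istep_contested; first by move: lA; rewrite inE => /eqP.
    by rewrite overrideE eqxx.
  have fAB : f \in iactive h :\: iactive (rcons h y).
    by rewrite !inE iheld_rcons hr fS fA.
  have {}fl : (f < l)%N.
    rewrite ltn_neqAle fl andbT; apply/eqP => /val_inj fl'.
    by move: fAB; rewrite fl' inE lB.
  have := rk_ltn (iactive_rcons _ _) fAB fl; case: (rk (iactive h) l) => // m rkm.
  rewrite ge_min; apply/orP; right; apply: le_trans lP; exact: contval_anti.
- by move=> l lB; rewrite ipayoff_cont // stayE.
- move=> l; rewrite inE => /andP[lNB lA]; right.
  have [hl [xl xlt]] := takeP _ _ lA lNB; split.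
  + rewrite /w; case: pickP => [l'|/(_ l)]; last by rewrite inE lA lNB.
    rewrite inE => /andP[l'NB l'A]; have [_ [xl' xlt']] := takeP _ _ l'A l'NB.
    suff /val_inj -> : val l' = val l by [].
    case: (ltngtP l' l) => // ll'.
      by have := xlt _ l'A ll'; rewrite xl'.
    by have := xlt' _ lA ll'; rewrite xl.
  + by rewrite ipayoff_cont // winE.
  (* All agents above the taker rejected, so any of them would have received the award by
     accepting. *)
  + move=> i iA il; apply: le_trans (icont_le_ipayoff pi0 i true hr rn).
    rewrite winE //; rewrite inE iheld_rcons hr (istepE rn); last first.
      by move: iA; rewrite inE => /eqP.
    rewrite overrideE eqxx (_ : [forall _, _]) //.
    apply/forallP => l'; apply/implyP => l'i; rewrite overrideE.
    rewrite -(inj_eq val_inj) ltn_eqF //; apply/negP => /andP[xl' l'A].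
    by have := xlt l'; rewrite inE l'A (ltn_trans l'i) // xl' => /(_ isT isT).
Qed.

End Equilibrium.
End ImmediateGame.

Lemma rk_setT k (j : 'I_k) : rk [set: 'I_k] j = j.
Proof.
rewrite /rk (_ : [set _ in _ | _] = [set widen_ord (ltnW (ltn_ord j)) i | i : 'I_j]).
  rewrite card_imset ?card_ord // => i i' /(congr1 val) /= ii'; exact: val_inj.
apply/setP => i; rewrite !inE /=; apply/idP/imsetP => [ij|[i' _ ->]] /=.
  by exists (Ordinal ij) => //; apply: val_inj.
exact: ltn_ord.
Qed.

(** The sum over all orders is first averaged over the fibers of the first observation, which turns
    its terms into payoffs of round 0. *)
Lemma iwin_value n k (sigma : istrategy n k) (i : nat) : iSPE sigma -> (i < k)%N ->
  iwin sigma i = (\sum_(pi : {perm 'I_n}) value 0 i pi) / #|{perm 'I_n}|%:R.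
Proof.
move=> Hs ik; rewrite /iwin insubT /=; congr (_ / _).
rewrite -(sum_cexp (g := @obs n 0)) //; apply: eq_bigr => pi _.
have act : iactive n [::] = [set: 'I_k].
  by apply/setP => j; rewrite !inE /iheld /= ffunE.
by rewrite [LHS]ipayoff_value // act ?rk_setT // inE.
Qed.

(** * Equilibria of the deferred-selection game *)

Lemma perm_top n (pi : {perm 'I_n}) : (0 < n)%N -> exists t, pi t = 0%N :> nat.
Proof. by move=> n0; exists (pi^-1%g (Ordinal n0)); rewrite permKV. Qed.

Lemma perm_top_inj n (pi : {perm 'I_n}) s t :
  pi s = 0%N :> nat -> pi t = 0%N :> nat -> s = t.
Proof. by move=> ps pt; apply: (@perm_inj _ pi); apply: val_inj; rewrite /= ps pt. Qed.

(** Only the best award seen so far can be the best of all, and the observation determines which one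
    that is. *)
Lemma obs_top_inj n r (pi pi' : {perm 'I_n}) (s t : 'I_n) : obs r pi = obs r pi' ->
  (s <= r)%N -> (t <= r)%N -> pi s = 0%N :> nat -> pi' t = 0%N :> nat -> s = t.
Proof.
move=> /ffunP eqo sr tr ps pt; apply/eqP/negPn/negP => st.
have := eqo (s, t); rewrite !ffunE /= !leq_min !ltnS sr tr !ltn_ord /= pt ltn0 ps.
rewrite lt0n => /negbT/negPn/eqP pit; move: st.
by rewrite (perm_top_inj ps pit) eqxx.
Qed.

(** * Play of the deferred-selection game *)

Section DeferredGame.
Variables n k : nat.
Implicit Types (sigma : dstrategy n k) (pi : {perm 'I_n}) (h : seq (dprofile n k)).
Implicit Types (a : dassignment n k) (x : dprofile n k) (j : 'I_k) (s : 'I_n).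

Definition dheld h : dassignment n k := dassign_from 0 (dempty n k) h.

Definition dactive h : {set 'I_k} := [set j | dheld h j == None].

Lemma dheld_rcons h x : dheld (rcons h x) = dstep (size h) (dheld h) x.
Proof.
rewrite /dheld; move: (dempty n k) => a; rewrite -[size h]add0n.
by elim: h 0%N a => [|y h IH] r a /=; rewrite ?addn0 // IH addSnnS.
Qed.

Lemma dheld_keep h x j s : dheld h j = Some s -> dheld (rcons h x) j = Some s.
Proof. by move=> hj; rewrite dheld_rcons ffunE hj. Qed.

Lemma dactive_rcons h x : dactive (rcons h x) \subset dactive h.
Proof.
apply/subsetP => j; rewrite !inE => hx.
by case hj: (dheld h j) hx => [s|] //; rewrite (dheld_keep _ hj).
Qed.

Lemma doutcome_keep sigma pi r h j s :
  dheld h j = Some s -> doutcome sigma pi r h j = Some s.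
Proof.
rewrite /doutcome; move: (_ - r)%N => d; elim: d r h => [|d IH] r h hj //=.
by apply: IH; apply: dheld_keep.
Qed.

Lemma doutcomeS sigma pi r h : (r < n)%N ->
  doutcome sigma pi r h =
  doutcome sigma pi r.+1 (rcons h [ffun j => sigma j r (obs r pi) h]).
Proof.
move=> rn; have rN : (r < horizon n k)%N := leq_trans rn (leq_addr _ _).
by rewrite /doutcome -(subnSK rN).
Qed.

Lemma eq_doutcome sigma sigma' pi r h :
  (forall j r' o h', (r <= r')%N -> sigma j r' o h' = sigma' j r' o h') ->
  doutcome sigma pi r h = doutcome sigma' pi r h.
Proof.
rewrite /doutcome => eqs; congr dassign_from.
move: (_ - r)%N => d; elim: d r h eqs => [|d IH] r h eqs //=.
rewrite (_ : finfun _ = [ffun j => sigma' j r (obs r pi) h]).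
  by apply: IH => j r' o h' rr'; apply: eqs; apply: ltnW.
by apply/ffunP => j; rewrite !ffunE eqs.
Qed.

Lemma dstep_taken r a x j s : a j = None -> dstep r a x j = Some s ->
  [/\ x j = Some s, (s < minn r.+1 n)%N, davailable a s &
      forall i : 'I_k, (i < j)%N -> a i = None -> x i <> Some s].
Proof.
move=> aj; rewrite ffunE aj; case xj: (x j) => [t|] //.
case: ifP => // /and3P[tr at_ /forallP xt] [<-]; split => // i ij ai xi.
by have := xt i; rewrite ij xi ai !eqxx.
Qed.

Lemma dstep_contested r a x j s : a j = None -> x j = Some s ->
    (s < minn r.+1 n)%N -> davailable a s ->
  exists f : 'I_k, [/\ (f <= j)%N, a f = None & dstep r a x f = Some s].
Proof.
move=> aj xj sr sa; pose S := [pred l : 'I_k | (x l == Some s) && (a l == None)].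
have jS : S j by rewrite /= xj aj !eqxx.
case: (arg_minnP (fun l : 'I_k => val l) jS) => f /andP[/eqP xf /eqP af] fmin.
exists f; split => //; first exact: fmin.
rewrite ffunE af xf sr sa (_ : [forall _, _]) //.
apply/forallP => l; apply/implyP => lf; apply/negP => lS.
by have := fmin l lS; rewrite leqNgt lf.
Qed.

Lemma dheld_lt h j s : dheld h j = Some s -> (s < size h)%N.
Proof.
elim/last_ind: h j s => [|h x IH] j s; first by rewrite /dheld ffunE.
rewrite size_rcons dheld_rcons; case hj: (dheld h j) => [t|].
  by rewrite ffunE hj => -[<-]; apply: ltnW; rewrite ltnS; apply: IH hj.
by move=> /(dstep_taken hj)[_]; rewrite leq_min => /andP[].
Qed.

Lemma dheld_inj h j j' s : dheld h j = Some s -> dheld h j' = Some s -> j = j'.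
Proof.
elim/last_ind: h j j' s => [|h x IH] j j' s; first by rewrite /dheld ffunE.
rewrite !dheld_rcons; case hj: (dheld h j) => [t|]; case hj': (dheld h j') => [t'|].
- by rewrite !ffunE hj hj' => -[<-] [tt]; apply: IH hj _; rewrite -tt.
- rewrite ffunE hj => -[ts] /(dstep_taken hj')[_ _ /forallP/(_ j)].
  by rewrite hj ts eqxx.
- move=> /(dstep_taken hj)[_ _ /forallP/(_ j') av _]; rewrite ffunE hj' => -[ts].
  by move: av; rewrite hj' ts eqxx.
- move=> /(dstep_taken hj)[xj _ _ xlt] /(dstep_taken hj')[xj' _ _ xlt'].
  case: (ltngtP j j') => [jj'|jj'|/val_inj //].
    by have := xlt' _ jj' hj.
  by have := xlt _ jj' hj'.
Qed.

Lemma doutcome_inj sigma pi r h j j' s :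
  doutcome sigma pi r h j = Some s -> doutcome sigma pi r h j' = Some s -> j = j'.
Proof. exact: dheld_inj. Qed.

Lemma availablePn a s : reflect (exists j, a j = Some s) (~~ davailable a s).
Proof.
apply: (iffP forallPn) => -[j]; first by rewrite negbK => /eqP; exists j.
by move=> aj; exists j; rewrite aj eqxx.
Qed.

Lemma dreceives_top pi a j s : a j = Some s -> pi s = 0%N :> nat ->
  dreceives pi a j 0.
Proof.
move=> aj ps; rewrite /dreceives aj cards_eq0; apply/eqP/setP => i; rewrite !inE.
by case: (a i) => // t; rewrite ps ltn0.
Qed.

Lemma dreceives_inj pi a j j' :
    (forall i i' s, a i = Some s -> a i' = Some s -> i = i') ->
  dreceives pi a j 0 -> dreceives pi a j' 0 -> j = j'.
Proof.
move=> a_inj; rewrite /dreceives.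
case aj: (a j) => [s|] //; case aj': (a j') => [s'|] //.
rewrite !cards_eq0 => /eqP/setP/(_ j'); rewrite !inE aj' => ss'.
move=> /eqP/setP/(_ j); rewrite !inE aj => s's.
apply: a_inj aj _; rewrite aj'; congr Some; apply: (@perm_inj _ pi).
apply: val_inj => /=; case: (ltngtP (pi s') (pi s)) => // lt.
  by rewrite lt in ss'.
by rewrite lt in s's.
Qed.

(** * Equilibrium payoffs of the deferred-selection game with many agents *)

Section Equilibrium.
Variable sigma : dstrategy n k.
Hypothesis Hsigma : dSPE sigma.
Hypothesis k_large : (n + #|{perm 'I_n}| < k)%N.

Definition dcont r h pi0 j : rat :=
  cexp (obs r) (fun pi => (dreceives pi (doutcome sigma pi r.+1 h) j 0)%:R) pi0.

Definition dpay r h pi0 j : rat := dpayoff sigma r h (obs r pi0) j 0%N.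

Definition dplay r h pi : dprofile n k := [ffun j => sigma j r (obs r pi) h].

Lemma dpay_ge0 r h pi0 j : 0 <= dpay r h pi0 j.
Proof. by apply: cexp_ge0 => ? _; rewrite ler0n. Qed.

Lemma dpay_cont r h pi0 j : (r < n)%N ->
  dpay r h pi0 j = dcont r (rcons h (dplay r h pi0)) pi0 j.
Proof.
by move=> rn; apply: eq_cexp => pi eqo; rewrite doutcomeS // /dplay eqo.
Qed.

Lemma dcont_le_dpay r h pi0 j b : size h = r -> (r < n)%N ->
  dcont r (rcons h (override (dplay r h pi0) j b)) pi0 j <= dpay r h pi0 j.
Proof.
move=> hr rn; rewrite leNgt; apply/negP.
pose dev r' o h' := if r' == r then b else sigma j r' o h'.
have rN : (r < horizon n k)%N := leq_trans rn (leq_addr _ _).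
suff -> : dcont r (rcons h (override (dplay r h pi0) j b)) pi0 j =
  dpayoff (ddeviate sigma j dev) r h (obs r pi0) j 0%N.
  move=> lt0; apply: (@Hsigma r h pi0 j dev hr rN).
  (* A gain in the first coordinate is already a lexicographic gain; index 0 exists because
     [r < n]. *)
  by exists (Ordinal (leq_ltn_trans (leq0n r) rn)); split.
apply: eq_cexp => pi eqo; rewrite [doutcome (ddeviate _ _ _) _ _ _]doutcomeS //.
rewrite (_ : [ffun l => ddeviate sigma j dev l r (obs r pi) h] =
             override (dplay r h pi0) j b); last first.
  apply/ffunP => l; rewrite !ffunE /ddeviate eqo.
  by case: eqP => // _; rewrite /dev eqxx.
congr (dreceives _ _ _ _)%:R; apply: eq_doutcome => l r' o h' rr'.
rewrite /ddeviate /dev; case: eqP => [->|//].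
by rewrite gtn_eqF.
Qed.

(* At most [n] agents are inactive, and for each order of the awards at most one
   agent wins. *)
Lemma hopeless_active r h pi0 : exists2 j, j \in dactive h & dpay r h pi0 j = 0.
Proof.
pose Z := [set j | 0 < dpay r h pi0 j].
have cardZ : (#|Z| <= #|{perm 'I_n}|)%N.
  pose f j := odflt 1%g [pick pi : {perm 'I_n} | dreceives pi (doutcome sigma pi r h) j 0].
  have fP j : j \in Z -> dreceives (f j) (doutcome sigma (f j) r h) j 0.
    rewrite inE => /cexp_bool_gt0P[pi _ pij]; rewrite /f.
    by case: pickP => [pi' //|/(_ pi)]; rewrite pij.
  rewrite -(@card_in_imset _ _ f); first exact: max_card.
  move=> j j' /fP + /fP + ff'; rewrite -ff'; apply: dreceives_inj => i i' s.
  exact: doutcome_inj.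
have cardI : (#|~: dactive h| <= n)%N.
  rewrite -(@card_in_imset _ _ (dheld h)); last first.
    move=> j j'; rewrite !inE; case hj: (dheld h j) => [s|] // _ _ hj'.
    by apply: dheld_inj hj _; rewrite -hj'.
  rewrite -[leqRHS]card_ord; apply: leq_trans (leq_imset_card Some 'I_n).
  apply/subset_leq_card/subsetP => _ /imsetP[j jI ->]; move: jI; rewrite !inE.
  by case: (dheld h j) => // s _; apply/imsetP; exists s.
have [jU|] := set_0Vmem (~: (Z :|: ~: dactive h)).
  have : (#|Z :|: ~: dactive h| < #|'I_k|)%N.
    rewrite card_ord; apply: leq_ltn_trans k_large; rewrite addnC.
    by apply: leq_trans (leq_add cardZ cardI); rewrite -cardsUI leq_addr.
  by rewrite -(cardsC (Z :|: ~: dactive h)) jU cards0 addn0 ltnn.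
move=> [j]; rewrite !inE negb_or negbK => /andP[jZ jA]; exists j; rewrite ?inE //.
by apply/eqP; rewrite eq_le dpay_ge0 leNgt jZ.
Qed.

(** If [s] were left over, no active agent would have selected it. An agent with payoff 0 could then
    select it, obtain it, and win under the order [pi1], so her deviation would be profitable. *)
Lemma possible_top_taken r h pi0 pi1 s : size h = r -> (r < n)%N -> (s <= r)%N ->
    obs r pi1 = obs r pi0 -> pi1 s = 0%N :> nat ->
  ~~ davailable (dheld (rcons h (dplay r h pi0))) s.
Proof.
move=> hr rn sr eqo ps; apply/negP => av'.
have av : davailable (dheld h) s.
  apply/negPn/negP => /availablePn[j hj]; move/forallP/(_ j): av'.
  by rewrite (dheld_keep _ hj) eqxx.
have sm : (s < minn r.+1 n)%N by rewrite leq_min ltnS sr ltn_ord.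
have nosel j : dheld h j = None -> dplay r h pi0 j <> Some s.
  move=> hj xj; have [f [_ _ hf]] := dstep_contested hj xj sm av.
  by move/forallP/(_ f): av'; rewrite dheld_rcons hr hf eqxx.
have [j jA pj] := hopeless_active r h pi0.
have := dcont_le_dpay pi0 j (Some s) hr rn; set y := override _ _ _.
rewrite pj leNgt => /negP; apply; apply/cexp_bool_gt0P; exists pi1 => //.
apply: (@dreceives_top _ _ _ s) => //; apply: doutcome_keep.
have hj : dheld h j = None by move: jA; rewrite inE => /eqP.
have yj : y j = Some s by rewrite overrideE eqxx.
have [f [fj hf yf]] := dstep_contested hj yj sm av.
have [+ _ _ _] := dstep_taken hf yf; rewrite overrideE; case: eqP => [<-|_].
  by rewrite dheld_rcons hr yf.
by move/(nosel _ hf).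
Qed.

(** The best award is gone by the end of round [r] if it is already revealed, and by the end of its
    own round otherwise. So the highest allocated award is the best of all. *)
Lemma top_allocated r h pi : size h = r -> (r < n)%N ->
  exists f s, doutcome sigma pi r h f = Some s /\ pi s = 0%N :> nat.
Proof.
elim: {r}(n - r)%N {-2}r (erefl (n - r)%N) h => [|d IH] r rd h hr rn; first by lia.
have [t pt] := perm_top pi (leq_ltn_trans (leq0n r) rn).
rewrite doutcomeS // -/(dplay r h pi); have [tr|rt] := leqP t r.
  have /availablePn[f hf] := possible_top_taken hr rn tr erefl pt.
  by exists f, t; split => //; apply: doutcome_keep.
have := ltn_ord t => tn; apply: IH; rewrite ?size_rcons ?hr //; last by exact: leq_trans tn.
by rewrite subnS rd.
Qed.

(** The invariant of equilibrium play. A deviation may break it, but one round of equilibrium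
    actions restores it, whatever the history. *)
Definition top_gone r h pi0 : Prop := forall pi s, obs r pi = obs r pi0 ->
  pi s = 0%N :> nat -> (s < r)%N -> ~~ davailable (dheld h) s.

(** The probability [c] of the deferred game. It also counts older awards still available, hence is
    at least [newtop], with equality under [top_gone]. *)
Definition topfree r h pi0 : rat :=
  cexp (obs r) (fun pi => (topin (fun s => (s <= r)%N && davailable (dheld h) s) pi)%:R) pi0.

Definition topprob r s pi0 : rat := cexp (obs r) (fun pi => (pi s == 0%N :> nat)%:R) pi0.

Lemma fresh_available r h s : size h = r -> s = r :> nat -> davailable (dheld h) s.
Proof.
move=> hr sr; apply/negPn/negP => /availablePn[j /dheld_lt].
by rewrite hr sr ltnn.
Qed.

Lemma newtop_le_topfree r h pi0 : size h = r -> newtop r pi0 <= topfree r h pi0.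
Proof.
move=> hr; apply: le_cexp => pi _; rewrite ler_nat.
case: (boolP (topin _ pi)) => // /existsP[s /andP[/eqP sr ps]].
rewrite lt0b; apply/existsP; exists s.
by rewrite ps sr leqnn (fresh_available hr sr).
Qed.

Lemma newtop_topfree r h pi0 : size h = r -> top_gone r h pi0 ->
  newtop r pi0 = topfree r h pi0.
Proof.
move=> hr gone; apply: eq_cexp => pi eqo; congr (nat_of_bool _)%:R.
apply/existsP/existsP => -[s /andP[]].
  by move=> /eqP sr ps; exists s; rewrite ps sr leqnn (fresh_available hr sr).
move=> /andP[sr av] /[dup] ps /eqP ps'; exists s; rewrite ps andbT eqn_leq sr.
by rewrite leqNgt; apply/negP => /(gone _ _ eqo ps'); rewrite av.
Qed.

Lemma topfree_topprob r h s pi0 pi1 : (s <= r)%N -> davailable (dheld h) s ->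
    obs r pi1 = obs r pi0 -> pi1 s = 0%N :> nat ->
  topfree r h pi0 = topprob r s pi0.
Proof.
move=> sr av eqo ps; apply: eq_cexp => pi eqo'; congr (nat_of_bool _)%:R.
apply/existsP/idP => [[t /andP[/andP[tr _] /eqP pt]]|ps']; last first.
  by exists s; rewrite sr av.
by rewrite (@obs_top_inj n r pi1 pi s t) ?pt // eqo eqo'.
Qed.

(** Only a lower bound, since [h] is arbitrary: a holder of [s] would also win with a lesser award
    if no better one were allocated. *)
Lemma dcont_taken r h pi0 j s : dheld h j = Some s ->
  topprob r s pi0 <= dcont r h pi0 j.
Proof.
move=> hj; apply: le_cexp => pi _; rewrite ler_nat; case: eqP => // ps.
by rewrite lt0b (@dreceives_top _ _ _ s) //; apply: doutcome_keep.
Qed.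

(** After equilibrium actions the bound is exact: by [top_allocated] the winner holds the best
    award. *)
Lemma dpay_taken r h pi0 j s : size h = r -> (r < n)%N ->
  dheld (rcons h (dplay r h pi0)) j = Some s -> dpay r h pi0 j = topprob r s pi0.
Proof.
move=> hr rn hj; apply: eq_cexp => pi eqo; congr (nat_of_bool _)%:R.
have oj : doutcome sigma pi r h j = Some s.
  by rewrite doutcomeS //; apply: doutcome_keep; rewrite /= eqo.
apply/idP/eqP => [dj|]; last exact: dreceives_top oj.
have [f [t [of_ pt]]] := top_allocated pi hr rn.
have fj : f = j.
  apply: dreceives_inj (dreceives_top of_ pt) dj => i i' u; exact: doutcome_inj.
by move: of_; rewrite fj oj => -[->].
Qed.

Lemma top_gone_step r h pi0 pi : size h = r -> (r < n)%N -> obs r pi = obs r pi0 ->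
  top_gone r.+1 (rcons h (dplay r h pi0)) pi.
Proof.
move=> hr rn eqo pi1 s eqo1 ps; rewrite ltnS => sr.
by apply: (possible_top_taken hr rn sr (pi1 := pi1)) => //; rewrite -eqo; apply: obs_refine.
Qed.

Lemma dcont_tower r h pi0 j : dcont r h pi0 j =
  cexp (obs r) (fun pi => dpay r.+1 h pi j) pi0.
Proof. by rewrite /dcont -(cexp_tower (g' := obs r.+1)) //; exact: obs_refine. Qed.

Lemma override_taken r h pi0 i s : size h = r -> (r < n)%N -> i \in dactive h ->
    (s <= r)%N -> davailable (dheld h) s ->
    (forall l, l \in dactive h -> (l < i)%N -> dplay r h pi0 l <> Some s) ->
  dheld (rcons h (override (dplay r h pi0) i (Some s))) i = Some s.
Proof.
move=> hr rn; rewrite inE => /eqP hi sr av nosel; set y := override _ _ _.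
have sm : (s < minn r.+1 n)%N by rewrite leq_min ltnS sr ltn_ord.
have yi : y i = Some s by rewrite overrideE eqxx.
have [f [fi hf yf]] := dstep_contested hi yi sm av.
have [+ _ _ _] := dstep_taken hf yf; rewrite overrideE; case: eqP => [<-|/eqP nfi].
  by rewrite dheld_rcons hr yf.
move/nosel; case; first by rewrite inE hf.
by rewrite ltn_neqAle fi andbT.
Qed.

(** The induction hypothesis has two halves: the lower bound covers histories reached by deviating,
    where [top_gone] may fail, and the equality covers equilibrium play. *)
Definition value_bounds r := forall h pi0 j, size h = r -> j \in dactive h ->
  value r (rk (dactive h) j) pi0 <= dpay r h pi0 j /\
  (top_gone r h pi0 -> dpay r h pi0 j = value r (rk (dactive h) j) pi0).

(** With every award revealed, [top_gone] says that the best one is held; its holder wins, so an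
    active agent cannot. *)
Lemma value_bounds_end : value_bounds n.
Proof.
move=> h pi0 j hn; rewrite inE => /eqP hj; rewrite value_end //.
split=> [|gone]; first exact: dpay_ge0.
rewrite -(cexp0 (obs n) pi0); apply: eq_cexp => pi eqo.
case: (boolP (dreceives _ _ _ _)) => // dj; exfalso.
have n0 : (0 < n)%N.
  move: dj; rewrite /dreceives; case: (doutcome _ _ _ _ _) => // s _.
  exact: leq_ltn_trans (ltn_ord s).
have [t pt] := perm_top pi n0.
have /availablePn[f hf] := gone _ _ eqo pt (ltn_ord t).
have dt := dreceives_top (doutcome_keep sigma pi n hf) pt.
suff fj : f = j by rewrite fj hj in hf.
by apply: dreceives_inj dt dj => i i' u; exact: doutcome_inj.
Qed.

(** An instance of [stage_value] with [c] equal to [topfree]. Deviations use the first half of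
    [value_bounds], agents who stay use the second. *)
Lemma dpay_insert r h pi0 : value_bounds r.+1 -> size h = r -> (r < n)%N ->
  forall j, j \in dactive h ->
  dpay r h pi0 j = insert (rk (dactive h) j) (topfree r h pi0) (contval r pi0).
Proof.
move=> IH hr rn.
have c_ge0 : 0 <= topfree r h pi0 by apply: cexp_ge0 => ? _; rewrite ler0n.
have contP y l : l \in dactive (rcons h y) ->
    contval r pi0 (rk (dactive (rcons h y)) l) <= dcont r (rcons h y) pi0 l.
  move=> lB; rewrite dcont_tower; apply: le_cexp => pi _.
  by have [] := IH _ pi _ _ lB; rewrite ?size_rcons ?hr.
set x := dplay r h pi0; pose B := dactive (rcons h x).
(* Several awards may be taken in one round, but only one of them can be the best. [w] is its taker,
   and the other leavers have payoff 0. *)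
pose w := [pick l in dactive h :\: B | dpay r h pi0 l != 0].
have takeP l : l \in dactive h -> l \notin B -> exists s,
    [/\ dheld (rcons h x) l = Some s, (s <= r)%N, davailable (dheld h) s &
        forall i, i \in dactive h -> (i < l)%N -> x i <> Some s].
  rewrite !inE => /eqP hl; case hl': (dheld _ _) => [s|] // _; exists s.
  move: (hl'); rewrite dheld_rcons hr => /(dstep_taken hl)[_ + av xlt].
  rewrite leq_min ltnS => /andP[sr _]; split => // i; rewrite inE => /eqP hi il.
  exact: xlt.
have topE s : (s <= r)%N -> davailable (dheld h) s -> topprob r s pi0 != 0 ->
    exists pi1, [/\ obs r pi1 = obs r pi0, pi1 s = 0%N :> nat &
                    topfree r h pi0 = topprob r s pi0].
  move=> sr av s0; have : 0 < topprob r s pi0.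
    by rewrite lt_neqAle eq_sym s0; apply: cexp_ge0 => ? _; rewrite ler0n.
  case/cexp_bool_gt0P => pi1 eqo /eqP ps; exists pi1; split => //.
  exact: topfree_topprob eqo ps.
apply: (@stage_value _ _ B w _ _ (fun j => dpay r h pi0 j)) => //.
- exact: dactive_rcons.
- exact: contval_anti.
- exact: contval_ge0.
- move=> l lA; rewrite /insert ge_max; apply/andP; split.
    apply: le_trans (dcont_le_dpay pi0 l None hr rn).
    apply: le_trans (contP _ _ _).
      exact: contval_anti (rk_mono _ (dactive_rcons _ _)).
    move: lA; rewrite !inE => /eqP hl; rewrite dheld_rcons hr ffunE hl.
    by rewrite overrideE eqxx.
  have [c_le0|c_gt0] := lerP (topfree r h pi0) 0.
    have cP : topfree r h pi0 <= dpay r h pi0 l := le_trans c_le0 (dpay_ge0 _ _ _ _).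
    by case: (rk _ _) => [//|m]; rewrite ge_min cP.
  case/cexp_bool_gt0P: c_gt0 => pi1 eqo /existsP[s /andP[/andP[sr av] /eqP ps]].
  have cE := topfree_topprob sr av eqo ps.
  have := dcont_le_dpay pi0 l (Some s) hr rn; set y := override _ _ _ => yP.
  have hl : dheld h l = None by move: lA; rewrite inE => /eqP.
  have yl : y l = Some s by rewrite overrideE eqxx.
  have sm : (s < minn r.+1 n)%N by rewrite leq_min ltnS sr ltn_ord.
  (* If the taker [f] of [s] is [l], she secures [c]. Otherwise [f] is above her, and [l] stays
     active with one agent fewer above her. *)
  have [f [fl hf yf]] := dstep_contested hl yl sm av.
  have {}yf : dheld (rcons h y) f = Some s by rewrite dheld_rcons hr.
  have [fl'|fl'] := eqVneq f l.
    have cP : topfree r h pi0 <= dpay r h pi0 l.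
      by rewrite cE; apply: le_trans yP; apply: dcont_taken; rewrite -fl'.
    by case: (rk _ _) => [//|m]; rewrite ge_min cP.
  have {}fl : (f < l)%N by rewrite ltn_neqAle fl andbT.
  have lB : l \in dactive (rcons h y).
    rewrite inE; case hl': (dheld _ _) => [t|] //.
    move: (hl'); rewrite dheld_rcons hr => /(dstep_taken hl)[+ _ _ _].
    rewrite yl => -[st]; move: fl'; rewrite (dheld_inj yf (j' := l)) ?eqxx //.
    by rewrite hl' st.
  have fAB : f \in dactive h :\: dactive (rcons h y) by rewrite !inE yf hf.
  have := rk_ltn (dactive_rcons _ _) fAB fl; case: (rk (dactive h) l) => // m rkm.
  rewrite ge_min; apply/orP; right; apply: le_trans yP.
  apply: le_trans (contP _ _ lB); exact: contval_anti.
- move=> l lB; rewrite dpay_cont // dcont_tower; apply: eq_cexp => pi eqo.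
  have hx : size (rcons h x) = r.+1 by rewrite size_rcons hr.
  by have [_ ->] := IH _ pi _ hx lB; last exact: top_gone_step.
- move=> l; rewrite inE => /andP[lB lA]; have [s [hl sr av slt]] := takeP _ lA lB.
  have lE := dpay_taken hr rn hl.
  have [->|l0] := eqVneq (dpay r h pi0 l) 0; [by left|right].
  move: (l0); rewrite lE => /(topE _ sr av)[pi1 [eqo ps cE]]; split => //.
  + rewrite /w; case: pickP => [l'|/(_ l)]; last by rewrite inE lA lB l0.
    rewrite inE => /andP[/andP[l'B l'A]]; have [s' [hl' sr' av' _]] := takeP _ l'A l'B.
    rewrite (dpay_taken hr rn hl') => /(topE _ sr' av')[pi1' [eqo' ps' _]].
    suff -> : l' = l by [].
    apply: dheld_inj hl' _; rewrite hl; congr Some.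
    exact: obs_top_inj (etrans eqo (esym eqo')) sr sr' ps ps'.
  + move=> i iA il; apply: le_trans (dcont_le_dpay pi0 i (Some s) hr rn).
    rewrite cE; apply: dcont_taken; apply: override_taken => // l' l'A l'i.
    exact: slt (ltn_trans l'i il).
Qed.

Lemma value_boundsP r : (r <= n)%N -> value_bounds r.
Proof.
elim: {r}(n - r)%N {-2}r (erefl (n - r)%N) => [|d IH] r rd rn.
  by rewrite (_ : r = n); [exact: value_bounds_end|lia].
have {}rn : (r < n)%N by lia.
have {}IH : value_bounds r.+1 by apply: IH => //; lia.
move=> h pi0 j hr jA; rewrite (dpay_insert pi0 IH hr rn jA) valueS //; split.
  by apply: le_insert => //; apply: newtop_le_topfree.
by move=> gone; rewrite (newtop_topfree hr gone).
Qed.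

Lemma dwin_value (i : nat) : (i < k)%N ->
  dwin sigma i = (\sum_(pi : {perm 'I_n}) value 0 i pi) / #|{perm 'I_n}|%:R.
Proof.
move=> ik; rewrite /dwin insubT /=; congr (_ / _).
rewrite -(sum_cexp (g := @obs n 0)) //; apply: eq_bigr => pi _.
have act : dactive [::] = [set: 'I_k].
  by apply/setP => j; rewrite !inE /dheld /= ffunE.
have jA : Ordinal ik \in dactive [::] by rewrite act inE.
(* At round 0 nothing was revealed earlier, so [top_gone] holds vacuously and the equality
   applies. *)
have [_ dE] := value_boundsP (leq0n n) pi (erefl : size [::] = 0%N) jA.
by rewrite [LHS]dE ?act ?rk_setT.
Qed.

End Equilibrium.
End DeferredGame.

(* Agent i (1-based, i.e. ordinal i.-1).  q_i is agent i's winning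
   probability in an SPE [tau] of the immediate-selection game with any
   number k0 >= i of agents; [sigma k] is an SPE of the k-agent deferred
   game; conclusion: p_{i,k} --> q_i as k --> oo. *)
Theorem theorem4 (n i k0 : nat) (hi : (1 <= i <= k0)%N)
    (tau : istrategy n k0) (Htau : iSPE tau)
    (sigma : forall k : nat, dstrategy n k)
    (Hsigma : forall k : nat, dSPE (sigma k)) :
  forall eps : rat, 0 < eps ->
    exists K : nat, forall k : nat, (K <= k)%N ->
      `|dwin (sigma k) i.-1 - iwin tau i.-1| < eps.
Proof.
(* This threshold ensures both that agent [i] exists and that [k] exceeds [n + n!]; from there on
   the difference is exactly 0. *)
move=> eps eps_gt0; exists (i + (n + #|{perm 'I_n}|)).+1 => k kK.
case/andP: hi => i_gt0 ik0.
rewrite iwin_value ?(leq_trans _ ik0) ?prednK // dwin_value //; last by lia.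
  by rewrite subrr normr0.
by apply: leq_trans kK; rewrite ltnS leq_addl.
Qed.
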